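(* For every fixed $t>0$, assume the symmetric kernel $k_t$ satisfies $\int\int k_t(y,x)^2\,p_H(y)\,p_H(x)\,dy\,dx=c_t^2<+\infty$, and let $K_t:\mathbb{H}\to\mathbb{H}$ be the continuous linear operator defined by $\langle K_tu,v\rangle_{\mathbb{H}}=\int_{\mathbb{R}^\nu}\int_{\mathbb{R}^\nu}k_t(y,x)\,u(x)\,v(y)\,p_H(y)\,p_H(x)\,dy\,dx$ for all $u,v\in\mathbb{H}$. Then: (a) for all $u,v\in\mathbb{H}$, $\langle K_tu,v\rangle_{\mathbb{H}}=\sum_{\alpha\in\mathbb{N}}b_\alpha(t)\langle u,\psi_\alpha\rangle_{\mathbb{H}}\langle v,\psi_\alpha\rangle_{\mathbb{H}}$, $K_t$ is a positive symmetric operator on $\mathbb{H}$, and $K_tu=\sum_{\alpha}b_\alpha(t)\langle u,\psi_\alpha\rangle_{\mathbb{H}}\psi_\alpha$; (b) for all $\alpha\in\mathbb{N}$, $\psi_\alpha\in\mathbb{H}$ is an eigenfunction, independent of $t$, of $K_t$ for the positive eigenvalue $b_\alpha(t)=\exp(-\lambda_\alpha t)$: $K_t\psi_\alpha=b_\alpha(t)\psi_\alpha$, where $1=b_0(t)>b_1(t)\ge b_2(t)\ge\cdots$; consequently $\langle K_t\psi_\alpha,\psi_\beta\rangle_{\mathbb{H}}=b_\alpha(t)\delta_{\alpha\beta}$ for all $\alpha,\beta$; (c) for all $u\in\mathbb{H}$, $\|K_tu\|_{\mathbb{H}}^2=\sum_\alpha b_\alpha(t)^2\langle u,\psi_\alpha\rangle_{\mathbb{H}}^2$,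 and $\sum_{\alpha\in\mathbb{N}}\|K_t\psi_\alpha\|_{\mathbb{H}}^2=c_t^2=\sum_\alpha b_\alpha(t)^2<+\infty$; therefore $K_t$ is a Hilbert–Schmidt operator on $\mathbb{H}$.
   Context: Let $\nu\ge1$, $n_d>1$, and $\eta^1,\dots,\eta^{n_d}\in\mathbb{R}^\nu$ with $\frac1{n_d}\sum_j\eta^j=0$, $\frac1{n_d-1}\sum_j\eta^j(\eta^j)^T=I_\nu$. Put $s=\big(\frac{4}{n_d(2+\nu)}\big)^{1/(\nu+4)}$, $\hat s=s/\sqrt{s^2+(n_d-1)/n_d}$, $p_H(\eta)=\frac1{n_d}\sum_{j}(\sqrt{2\pi}\,\hat s)^{-\nu}\exp(-\frac{1}{2\hat s^2}\|\eta-\frac{\hat s}{s}\eta^j\|^2)$ (strictly positive, continuous) and $\Phi=-\log\big((\sqrt{2\pi}\hat s)^{\nu}p_H\big)$. Let $\mathbb{H}=L^2(\mathbb{R}^\nu;p_H)$ with $\langle u,v\rangle_{\mathbb{H}}=\int uv\,p_H\,dy$. Let $\hat L(q)=\mathcal{V}q-\frac12\nabla^2q$ with $\mathcal{V}=\frac18\|\nabla\Phi\|^2-\frac14\nabla^2\Phi$, with condition at infinity $\lim_{\|y\|\to\infty}p_H^{1/2}\|\nabla(p_H^{-1/2}q)\|=0$. Standing hypotheses: $\hat L$ has countable spectrum $0=\lambda_0<\lambda_1\le\lambda_2\le\cdots$ with finite multiplicities, and its eigenfunctions $\{q_\alpha\}$ form an orthonormal Hilbert basis of $L^2(\mathbb{R}^\nu)$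 with $q_0=p_H^{1/2}$. Put $\psi_\alpha=q_\alpha p_H^{-1/2}$ (an orthonormal Hilbert basis of $\mathbb{H}$ with $\psi_0\equiv1$). Let $\rho(y,t\,|\,x,0)$ be the transition density of the Itô SDE $dY=-\frac12\nabla\Phi(Y)\,dt+dW$ ($W$ a standard $\nu$-dimensional Wiener process) from $Y(0)=x$, assumed to admit for $t>0$ the representation $\rho(y,t\,|\,x,0)=p_H(y)^{1/2}p_H(x)^{-1/2}\sum_{\alpha}e^{-\lambda_\alpha t}q_\alpha(y)q_\alpha(x)$. Define $k_t(y,x)=\rho(y,t\,|\,x,0)/p_H(y)$ (symmetric in $(y,x)$) and $b_\alpha(t)=e^{-\lambda_\alpha t}$. *)

(* Defs.v *)
From HB Require Import structures.
From mathcomp Require Import all_boot all_order all_algebra.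
From mathcomp Require Import all_classical all_reals all_analysis.
Set Implicit Arguments. Unset Strict Implicit. Unset Printing Implicit Defensive.
Import Order.TTheory GRing.Theory Num.Theory.
Import numFieldNormedType.Exports.
Local Open Scope classical_set_scope.
Local Open Scope ring_scope.

Section prod_sfm.
Variable R : realType.
Context d1 d2 (T1 : measurableType d1) (T2 : measurableType d2).
Variables (m1 : {sigma_finite_measure set T1 -> \bar R})
          (m2 : {sigma_finite_measure set T2 -> \bar R}).
Lemma prod_sigma_finite : sigma_finite setT (m1 \x m2)%E.
Proof.
have /sigma_finiteP[F [TF ndF Foo]] := sigma_finiteT m1.
have /sigma_finiteP[G [TG ndG Goo]] := sigma_finiteT m2.
exists (fun n => F n `*` G n).
 rewrite -setXTT TF TG predeqE => -[x y]; split.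
    move=> [/= [n _ Fnx] [k _ Gky]]; exists (maxn n k) => //; split.
    - by move: x Fnx; exact/subsetPset/ndF/leq_maxl.
    - by move: y Gky; exact/subsetPset/ndG/leq_maxr.
  by move=> [n _ []/= ? ?]; split; exists n.
move=> k; have [? ?] := Foo k; have [? ?] := Goo k.
split; first exact: measurableX.
by rewrite product_measure1E// lte_mul_pinfty// ge0_fin_numE.
Qed.
Definition prod_sfm : {sigma_finite_measure set (T1 * T2)%type -> \bar R} :=
  HB.pack_for {sigma_finite_measure set (T1 * T2)%type -> \bar R} (m1 \x m2)%E
    (Measure_isSigmaFinite.Build _ _ _ (m1 \x m2)%E prod_sigma_finite).
End prod_sfm.

Section Rn.
Variable R : realType.

Record packed := Pack {
  pdisp : measure_display;
  pT : measurableType pdisp;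
  pm : {sigma_finite_measure set pT -> \bar R} }.

(** [lebn n] : Lebesgue measure on R^(n+1) = R * (R * ( ... * R)) *)
Fixpoint lebn (n : nat) : packed :=
  match n with
  | 0 => @Pack _ _ (@lebesgue_measure R)
  | n'.+1 => @Pack _ _ (@prod_sfm R _ _ _ _ (@lebesgue_measure R) (pm (lebn n')))
  end.

(** i-th coordinate (0-based) of a point of R^(n+1) *)
Fixpoint coordn (n : nat) : pT (lebn n) -> nat -> R :=
  match n return pT (lebn n) -> nat -> R with
  | 0 => fun y _ => (y : R)
  | n'.+1 => fun y i => if i is i'.+1 then @coordn n' y.2 i' else (y.1 : R)
  end.

Fixpoint shiftn (n : nat) : pT (lebn n) -> nat -> R -> pT (lebn n) :=
  match n return pT (lebn n) -> nat -> R -> pT (lebn n) with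
  | 0 => fun y i h => if i is 0 then ((y : R) + h : R) else y
  | n'.+1 => fun y i h =>
      if i is i'.+1 then (y.1, @shiftn n' y.2 i' h) else (((y.1 : R) + h : R), y.2)
  end.
End Rn.

(** R^nu (nu >= 1) and its Lebesgue measure *)
Definition Rsp (R : realType) (nu : nat) : Type := pT (lebn R nu.-1).
Definition leb (R : realType) (nu : nat) := pm (lebn R nu.-1).
Definition coordp (R : realType) (nu : nat) (y : Rsp R nu) (i : nat) : R :=
  coordn y i.
Definition shiftp (R : realType) (nu : nat) (y : Rsp R nu) (i : nat) (h : R)
  : Rsp R nu := shiftn y i h.

Section Setting.
Variables (R : realType) (nu nd : nat) (eta : 'I_nd -> 'I_nu -> R).
Local Notation X := (Rsp R nu).

Definition enorm (y : X) : R := Num.sqrt (\sum_(i < nu) coordp y i ^+ 2).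

Definition pdiff (f : X -> R) (i : nat) (y : X) : R :=
  derive1 (fun h : R => f (shiftp y i h)) 0.
Definition gradsq (f : X -> R) (y : X) : R := \sum_(i < nu) (pdiff f i y) ^+ 2.
Definition lap (f : X -> R) (y : X) : R := \sum_(i < nu) pdiff (pdiff f i) i y.

Definition s_bw : R :=
  (4 / (nd%:R * (2 + nu%:R))) `^ (1 / (nu%:R + 4)).
Definition shat : R := s_bw / Num.sqrt (s_bw ^+ 2 + (nd%:R - 1) / nd%:R).

Definition pH (y : X) : R :=
  1 / nd%:R * \sum_(j < nd)
    (Num.sqrt (2 * pi) * shat) ^- nu *
      expR (- (\sum_(i < nu) (coordp y i - shat / s_bw * eta j i) ^+ 2)
              / (2 * shat ^+ 2)).

Definition Phi (y : X) : R := - ln ((Num.sqrt (2 * pi) * shat) ^+ nu * pH y).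

Definition Vpot (y : X) : R := gradsq Phi y / 8 - lap Phi y / 4.

Definition Lhat (q : X -> R) (y : X) : R := Vpot y * q y - lap q y / 2.

Definition inH (u : X -> R) : Prop :=
  measurable_fun setT u /\
  (\int[leb R nu]_y ((u y) ^+ 2 * pH y)%:E < +oo)%E.
Definition ipH (u v : X -> R) : R :=
  Rintegral (leb R nu) setT (fun y => u y * v y * pH y).
Definition normH (u : X -> R) : R := Num.sqrt (ipH u u).

(** orthonormal Hilbert basis of H (equality in H is a.e. equality) *)
Definition hilbert_basisH (e : nat -> X -> R) : Prop :=
  (forall a, inH (e a)) /\
  (forall a b, ipH (e a) (e b) = (a == b)%:R) /\
  (forall u, inH u -> (forall a, ipH u (e a) = 0) ->
     {ae leb R nu, forall y, u y = 0}).

Definition hilbert_schmidtH (K : (X -> R) -> (X -> R)) : Prop :=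
  exists e : nat -> X -> R, hilbert_basisH e /\
    exists l : R, (\sum_(a < n) normH (K (e a)) ^+ 2) @[n --> \oo] --> l.
End Setting.

Section Derived.
Variables (R : realType) (nu nd : nat) (eta : 'I_nd -> 'I_nu -> R).
Local Notation X := (Rsp R nu).
Definition psi (q : nat -> X -> R) (a : nat) (y : X) : R :=
  q a y / Num.sqrt (pH eta y).
Definition kt (rho : R -> X -> X -> R) (t : R) (y x : X) : R :=
  rho t y x / pH eta y.
End Derived.
Definition bt (R : realType) (lam : nat -> R) (t : R) (a : nat) : R :=
  expR (- (lam a * t)).

(* Main.v *)
Require Import Defs.
From HB Require Import structures.
From mathcomp Require Import all_boot all_order all_algebra.
From mathcomp Require Import all_classical all_reals all_analysis.
From mathcomp Require Import measurable_realfun.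
From mathcomp Require Import ring lra zify.
Set Implicit Arguments. Unset Strict Implicit. Unset Printing Implicit Defensive.
Import Order.TTheory GRing.Theory Num.Theory.
Import numFieldNormedType.Exports.
Local Open Scope classical_set_scope.
Local Open Scope ring_scope.

(* For fixed [x], the section [k_t(., x) = sum_a b_a psi_a(x) psi_a] of the kernel has
   square-summable coefficients: the expansion converges on the diagonal and
   [0 < b_a <= 1].  By Fatou's lemma the pointwise series then also converges in [H],
   so it can be integrated term by term against any [v] in [H]; integrating once more
   against [u] diagonalises the bilinear form of [K_t]:
   [<K_t u, v> = sum_a b_a <u, psi_a> <v, psi_a>].  Symmetry, positivity, the
   expansion of [K_t u] and of [||K_t u||^2] follow, the eigen-relations hold a.e. by
   completeness of the [psi_a], and [c_t^2 = sum_a b_a^2] is Parseval's identity for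
   each section followed by monotone convergence in [x]. *)

Section weighted_L2.
Context d (T : measurableType d) (R : realType).
Variables (mu : {measure set T -> \bar R}) (w : T -> R).

Definition wL2 (f : T -> R) : Prop := measurable_fun setT f /\
  (\int[mu]_x ((f x) ^+ 2 * w x)%:E < +oo)%E.

Definition wdot (f g : T -> R) : R := Rintegral mu setT (fun x => f x * g x * w x).

Definition wnorm (f : T -> R) : R := Num.sqrt (wdot f f).

Lemma wdotC f g : wdot f g = wdot g f.
Proof. by apply: eq_Rintegral => x _; rewrite (mulrC (f x)). Qed.

Hypothesis mw : measurable_fun setT w.
Hypothesis w_ge0 : forall x, 0 <= w x.

Lemma wL2_sqr_integrable f : wL2 f ->
  mu.-integrable setT (EFin \o (fun x => f x ^+ 2 * w x)).
Proof.
case=> mf fi; apply/integrableP; split.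
  by apply/measurable_EFinP; apply: measurable_funM => //; exact: measurable_funX.
rewrite (eq_integral (fun x => (f x ^+ 2 * w x)%:E)) // => x _ /=.
by rewrite ger0_norm // mulr_ge0 // sqr_ge0.
Qed.

Lemma wL2_integrable_mul f g : wL2 f -> wL2 g ->
  mu.-integrable setT (EFin \o (fun x => f x * g x * w x)).
Proof.
move=> Lf Lg; have [mf _] := Lf; have [mg _] := Lg.
apply: (le_integrable _ _ _ (integrableD measurableT (wL2_sqr_integrable Lf)
                                                   (wL2_sqr_integrable Lg))) => //.
  by apply/measurable_EFinP; apply: measurable_funM => //; exact: measurable_funM.
move=> x _ /=; rewrite lee_fin [leRHS]ger0_norm; last first.
  by rewrite addr_ge0 // mulr_ge0 // sqr_ge0.
rewrite !normrM (ger0_norm (w_ge0 x)) -mulrDl ler_wpM2r //.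
rewrite -(real_normK (num_real (f x))) -(real_normK (num_real (g x))).
have := sqr_ge0 (`|f x| - `|g x|); nra.
Qed.

Lemma wL2_lin r f g : wL2 f -> wL2 g -> wL2 (fun x => r * f x + g x).
Proof.
move=> Lf Lg; have [mf _] := Lf; have [mg _] := Lg.
have mrfg : measurable_fun setT (fun x => r * f x + g x).
  by apply: measurable_funD => //; exact: measurable_funM.
have msq : measurable_fun setT (fun x => ((r * f x + g x) ^+ 2 * w x)%:E).
  by apply/measurable_EFinP; apply: measurable_funM => //; exact: measurable_funX.
have /integrableP[mh fin] : mu.-integrable setT
    (EFin \o (fun x => 2 * r ^+ 2 * (f x ^+ 2 * w x) + 2 * (g x ^+ 2 * w x))).
  apply: (eq_integrable measurableT _ _ _ (integrableD measurableT
    (integrableZl measurableT _ (wL2_sqr_integrable Lf))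
    (integrableZl measurableT _ (wL2_sqr_integrable Lg)))) => x _ //.
split => //; rewrite (le_lt_trans _ fin) //; apply: ge0_le_integral => //.
- by move=> x _; rewrite lee_fin mulr_ge0 ?sqr_ge0.
- exact: measurableT_comp _ mh.
- move=> x _ /=; rewrite lee_fin.
  have := mulr_ge0 (sqr_ge0 r) (mulr_ge0 (sqr_ge0 (f x)) (w_ge0 x)).
  have := mulr_ge0 (sqr_ge0 (g x)) (w_ge0 x).
  have := mulr_ge0 (sqr_ge0 (r * f x - g x)) (w_ge0 x).
  by move=> *; rewrite ger0_norm; lra.
Qed.

Lemma wL2_0 : wL2 (fun _ => 0).
Proof.
split; first exact: measurable_cst.
under eq_integral do rewrite expr0n mul0r.
by rewrite integral0.
Qed.

Lemma wL2Z r f : wL2 f -> wL2 (fun x => r * f x).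
Proof.
move=> Lf; have := wL2_lin r Lf wL2_0.
by under eq_fun do rewrite addr0.
Qed.

Lemma wL2B f g : wL2 f -> wL2 g -> wL2 (fun x => f x - g x).
Proof.
move=> Lf Lg; have := wL2_lin (-1) Lg Lf.
by under eq_fun do rewrite mulN1r addrC.
Qed.

Lemma wL2_sum I (s : seq I) (c : I -> R) (e : I -> T -> R) :
  (forall i, wL2 (e i)) -> wL2 (fun x => \sum_(i <- s) c i * e i x).
Proof.
move=> Le; elim: s => [|i s IH].
  by under eq_fun do rewrite big_nil; exact: wL2_0.
by under eq_fun do rewrite big_cons; exact: wL2_lin.
Qed.

Lemma wdot_linl r f h g : wL2 f -> wL2 h -> wL2 g ->
  wdot (fun x => r * f x + h x) g = r * wdot f g + wdot h g.
Proof.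
move=> Lf Lh Lg; rewrite /wdot -RintegralZl //; last exact: wL2_integrable_mul.
rewrite -RintegralD //; last exact: wL2_integrable_mul.
  by apply: eq_Rintegral => x _; ring.
exact: (integrableZl measurableT r (wL2_integrable_mul Lf Lg)).
Qed.

Lemma wdot0l g : wdot (fun _ => 0) g = 0.
Proof.
by rewrite /wdot; under eq_Rintegral do rewrite !mul0r; rewrite Rintegral_cst // mul0r.
Qed.

Lemma wdotZl r f g : wL2 f -> wL2 g -> wdot (fun x => r * f x) g = r * wdot f g.
Proof.
move=> Lf Lg; have := wdot_linl r Lf wL2_0 Lg.
by rewrite wdot0l addr0; under eq_fun do rewrite addr0.
Qed.

Lemma wdotBl f h g : wL2 f -> wL2 h -> wL2 g ->
  wdot (fun x => f x - h x) g = wdot f g - wdot h g.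
Proof.
move=> Lf Lh Lg; have := wdot_linl (-1) Lh Lf Lg.
by rewrite mulN1r addrC; under eq_fun do rewrite mulN1r addrC.
Qed.

Lemma wdot_suml I (s : seq I) (c : I -> R) (e : I -> T -> R) g :
  (forall i, wL2 (e i)) -> wL2 g ->
  wdot (fun x => \sum_(i <- s) c i * e i x) g = \sum_(i <- s) c i * wdot (e i) g.
Proof.
move=> Le Lg; elim: s => [|i s IH].
  by rewrite big_nil; under eq_fun do rewrite big_nil; exact: wdot0l.
rewrite big_cons -IH -wdot_linl //; last exact: wL2_sum.
by under eq_fun do rewrite big_cons.
Qed.

Lemma wdot_ge0 f : 0 <= wdot f f.
Proof. by apply: Rintegral_ge0 => x _; rewrite mulr_ge0 // -expr2 sqr_ge0. Qed.

Lemma wnorm_sqr f : wnorm f ^+ 2 = wdot f f.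
Proof. by rewrite sqr_sqrtr // wdot_ge0. Qed.

Lemma wdot_sqrB f g : wL2 f -> wL2 g ->
  wdot (fun x => f x - g x) (fun x => f x - g x) = wdot f f - 2 * wdot f g + wdot g g.
Proof.
move=> Lf Lg; have Lfg := wL2B Lf Lg.
rewrite wdotBl // !(wdotC _ (fun x => f x - g x)) !wdotBl // (wdotC g f); ring.
Qed.

Lemma wL2_integralE f : wL2 f -> (\int[mu]_x ((f x) ^+ 2 * w x)%:E)%E = (wdot f f)%:E.
Proof.
move=> Lf; rewrite /wdot /Rintegral fineK; last first.
  exact: integrable_fin_num (wL2_sqr_integrable Lf).
by apply: eq_integral => x _; rewrite expr2.
Qed.

Lemma wdot_sqr_le f g : wL2 f -> wL2 g -> wdot f g ^+ 2 <= wdot f f * wdot g g.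
Proof.
move=> Lf Lg.
have quad r : 0 <= r ^+ 2 * wdot f f + 2 * r * wdot f g + wdot g g.
  have Lrfg := wL2_lin r Lf Lg.
  have := wdot_ge0 (fun x => r * f x + g x).
  rewrite wdot_linl // !(wdotC _ (fun x => r * f x + g x)) !wdot_linl // (wdotC g f).
  lra.
set A := wdot f f in quad *; set B := wdot g g in quad *; set C := wdot f g in quad *.
have [A0|A_neq0] := eqVneq A 0.
  have [C0|C_neq0] := eqVneq C 0; first by rewrite C0 A0 expr0n mul0r.
  have := quad (- (B + 1) / (2 * C)).
  by rewrite A0 mulr0 add0r (_ : 2 * _ * C = - (B + 1)); [lra | field].
have A_gt0 : 0 < A by rewrite lt0r A_neq0 wdot_ge0.
have := quad (- C / A).
rewrite (_ : _ + _ + B = (A * B - C ^+ 2) / A); last by field.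
by rewrite pmulr_lge0 ?invr_gt0 // subr_ge0.
Qed.

Lemma wdot_cvg0 (h : nat -> T -> R) v : (forall n, wL2 (h n)) -> wL2 v ->
  wdot (h n) (h n) @[n --> \oo] --> 0 -> wdot (h n) v @[n --> \oo] --> 0.
Proof.
move=> Lh Lv hh0.
have bound0 : Num.sqrt (wdot (h n) (h n) * wdot v v) @[n --> \oo] --> 0.
  rewrite -sqrtr0 -(mul0r (wdot v v)).
  exact: continuous_cvg (@sqrt_continuous R _) (cvgM hh0 (cvg_cst _)).
have nbound0 : - Num.sqrt (wdot (h n) (h n) * wdot v v) @[n --> \oo] --> 0.
  by rewrite -oppr0; exact: cvgN.
apply: (squeeze_cvgr _ nbound0 bound0).
near=> n; rewrite -ler_norml -sqrtr_sqr ler_wsqrtr //.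
exact: wdot_sqr_le.
Unshelve. all: by end_near.
Qed.
End weighted_L2.

Lemma sum_delta (R : realType) (F : nat -> R) (a n : nat) :
  \sum_(i < n) F i * ((i : nat) == a)%:R = if (a < n)%N then F a else 0.
Proof.
elim: n => [|n IH]; first by rewrite big_ord0.
rewrite big_ord_recr /= IH [in RHS]ltnS [in RHS]leq_eqVlt.
have [->|an] := eqVneq a n; first by rewrite ltnn mulr1 add0r.
by rewrite mulr0 addr0.
Qed.

Lemma psum_nondecreasing (R : realType) (u : nat -> R) : (forall a, 0 <= u a) ->
  {homo (fun n => \sum_(a < n) u a) : n m / (n <= m)%N >-> n <= m}.
Proof.
move=> u_ge0 n m nm /=; rewrite (big_ord_widen m u nm).
by rewrite [leRHS](bigID (fun i : 'I_m => (i < n)%N)) /= lerDl sumr_ge0.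
Qed.

Lemma EFin_cvgn (R : realType) (u : nat -> R) (l : R) :
  u n @[n --> \oo] --> l -> (u n)%:E @[n --> \oo] --> l%:E.
Proof. by move=> ul; apply: cvg_comp ul _. Qed.

Lemma cvgn_psum_bounded (R : realType) (u : nat -> R) (M : R) :
  (forall a, 0 <= u a) -> (forall n, \sum_(a < n) u a <= M) ->
  cvgn (fun n => \sum_(a < n) u a).
Proof.
move=> u_ge0 uM; apply: nondecreasing_is_cvgn; first exact: psum_nondecreasing.
by exists M => _ [n _ <-].
Qed.

Lemma nneseries_EFin_cvgP (R : realType) (u : nat -> R) (l : R) :
  (forall a, 0 <= u a) ->
  (\sum_(a <oo) (u a)%:E)%E = l%:E <-> \sum_(a < n) u a @[n --> \oo] --> l.
Proof.
move=> u_ge0; have psumE : (fun n => (\sum_(0 <= a < n) (u a)%:E)%E) =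
    (fun n => (\sum_(a < n) u a)%:E).
  by apply/funext => n; rewrite sumEFin big_mkord.
split=> [ul|ul]; last by apply: cvg_lim => //; rewrite psumE; exact: EFin_cvgn.
have : (\sum_(0 <= a < n) (u a)%:E)%E @[n --> \oo] --> l%:E.
  by rewrite -ul; apply: is_cvg_nneseries => a _ _; rewrite lee_fin.
by rewrite psumE => /fine_cvg.
Qed.

Section orthonormal_expansion.
Context d (T : measurableType d) (R : realType).
Variables (mu : {measure set T -> \bar R}) (w : T -> R).
Hypothesis mw : measurable_fun setT w.
Hypothesis w_ge0 : forall x, 0 <= w x.
Local Notation wL2 := (wL2 mu w).
Local Notation wdot := (wdot mu w).
Variable e : nat -> T -> R.
Hypothesis eL2 : forall a, wL2 (e a).
Hypothesis e_orthonormal : forall a b, wdot (e a) (e b) = (a == b)%:R.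

Lemma wL2_psum (c : nat -> R) n : wL2 (fun x => \sum_(a < n) c a * e a x).
Proof. exact: wL2_sum. Qed.

Lemma wdot_psuml (c : nat -> R) n g : wL2 g ->
  wdot (fun x => \sum_(a < n) c a * e a x) g = \sum_(a < n) c a * wdot (e a) g.
Proof. exact: wdot_suml. Qed.

Lemma wdot_psum_e (c : nat -> R) n b :
  wdot (fun x => \sum_(a < n) c a * e a x) (e b) = if (b < n)%N then c b else 0.
Proof.
rewrite wdot_psuml //; under eq_bigr do rewrite e_orthonormal.
exact: sum_delta.
Qed.

Lemma psum_wdot_e (c : nat -> R) n a :
  \sum_(i < n) c i * wdot (e a) (e i) = if (a < n)%N then c a else 0.
Proof. by under eq_bigr do rewrite e_orthonormal eq_sym; exact: sum_delta. Qed.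

Lemma cvgn_psum_wdot_e (c : nat -> R) a :
  \sum_(i < n) c i * wdot (e a) (e i) @[n --> \oo] --> c a.
Proof.
apply: cvg_near_cst; near=> n; rewrite psum_wdot_e ifT //.
by near: n; exists a.+1.
Unshelve. all: by end_near.
Qed.

Lemma wdot_psum (c : nat -> R) n :
  wdot (fun x => \sum_(a < n) c a * e a x) (fun x => \sum_(a < n) c a * e a x)
  = \sum_(a < n) c a ^+ 2.
Proof.
rewrite wdot_psuml; last exact: wL2_psum.
by apply: eq_bigr => a _; rewrite wdotC wdot_psum_e ltn_ord expr2.
Qed.

Lemma wdot_sub_psum f (c : nat -> R) n : wL2 f ->
  (forall a, (a < n)%N -> wdot f (e a) = c a) ->
  wdot (fun x => f x - \sum_(a < n) c a * e a x)
       (fun x => f x - \sum_(a < n) c a * e a x)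
  = wdot f f - \sum_(a < n) c a ^+ 2.
Proof.
move=> Lf fc; rewrite (wdot_sqrB mw w_ge0) //; last exact: wL2_psum.
rewrite wdotC wdot_psuml // wdot_psum.
under eq_bigr => a _ do rewrite wdotC fc // -expr2.
ring.
Qed.

Lemma bessel v n : wL2 v -> \sum_(a < n) wdot v (e a) ^+ 2 <= wdot v v.
Proof.
move=> Lv; rewrite -subr_ge0 -(wdot_sub_psum (c := fun a => wdot v (e a))) //.
exact: wdot_ge0.
Qed.

Section pointwise_limit.
Variable c : nat -> R.
Local Notation s n := (fun x => \sum_(a < n) c a * e a x).
Local Notation S n := (\sum_(a < n) c a ^+ 2).
Hypothesis S_cvg : cvgn (fun n => S n).
Variable g : T -> R.
Hypothesis s_cvg : forall x, s n x @[n --> \oo] --> g x.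

Let L := limn (fun n => S n).

Let S_le_L n : S n <= L.
Proof.
exact: nondecreasing_cvgn_le (psum_nondecreasing (fun a => sqr_ge0 (c a))) S_cvg n.
Qed.

Let mg : measurable_fun setT g.
Proof.
apply: (measurable_fun_cvg (h := fun n => s n)) => [m|x _]; last exact: s_cvg.
by have [] := wL2_psum c m.
Qed.

(* Fatou's lemma applied to the tails [s (m + n) - s n] of the expansion. *)
Let tail_integral_le n :
  (\int[mu]_x ((g x - s n x) ^+ 2 * w x)%:E <= (L - S n)%:E)%E.
Proof.
pose f m x := ((s (m + n) x - s n x) ^+ 2 * w x)%:E.
have Ls m : wL2 (s m) := wL2_psum c m.
have mf m : measurable_fun setT (f m).
  apply/measurable_EFinP; apply: measurable_funM => //; apply: measurable_funX.
  by apply: measurable_funB; [case: (Ls (m + n)%N) | case: (Ls n)].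
have f_ge0 m x : setT x -> (0 <= f m x)%E.
  by move=> _; rewrite lee_fin mulr_ge0 ?sqr_ge0.
have f_cvg x : f m x @[m --> \oo] --> ((g x - s n x) ^+ 2 * w x)%:E.
  have sx : s (m + n) x - s n x @[m --> \oo] --> g x - s n x.
    apply: cvgB; last exact: cvg_cst.
    by rewrite (cvg_shiftn n (fun m => s m x)); exact: s_cvg.
  by apply: EFin_cvgn; apply: cvgM; [rewrite expr2; exact: cvgM | exact: cvg_cst].
have int_f m : (\int[mu]_x f m x = (S (m + n) - S n)%:E)%E.
  rewrite wL2_integralE //; last exact: wL2B.
  rewrite (wdot_sub_psum (c := c)) // ?wdot_psum // => a an.
  by rewrite wdot_psum_e (leq_trans an (leq_addl _ _)).
have := fatou mu measurableT mf f_ge0.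
have -> : (\int[mu]_(x in setT) limn_einf (f^~ x))%E =
    (\int[mu]_x ((g x - s n x) ^+ 2 * w x)%:E)%E.
  by apply: eq_integral => x _; exact: (cvg_limn_einf_sup (f_cvg x)).1.
rewrite (_ : (fun m => _) = fun m => (S (m + n) - S n)%:E); last first.
  by apply/funext => m; exact: int_f.
have S_tail : (S (m + n) - S n)%:E @[m --> \oo] --> (L - S n)%:E.
  apply: EFin_cvgn; apply: cvgB; last exact: cvg_cst.
  by rewrite (cvg_shiftn n (fun m => S m)); exact: S_cvg.
by rewrite (cvg_limn_einf_sup S_tail).1.
Qed.

Let wL2_sub_limit n : wL2 (fun x => g x - s n x).
Proof.
split; last exact: le_lt_trans (tail_integral_le n) (ltry _).
by apply: measurable_funB => //; have [] := wL2_psum c n.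
Qed.

Lemma wL2_pointwise_limit : wL2 g.
Proof. by have := wL2_sub_limit 0; under eq_fun do rewrite big_ord0 subr0. Qed.

Lemma wdot_pointwise_limit v : wL2 v ->
  \sum_(a < n) c a * wdot v (e a) @[n --> \oo] --> wdot g v.
Proof.
move=> Lv.
have tail0 : L - S n @[n --> \oo] --> 0.
  by rewrite -[X in _ --> X](subrr L); apply: cvgB; [exact: cvg_cst | exact: S_cvg].
have sub0 : wdot (fun x => g x - s n x) v @[n --> \oo] --> 0.
  apply: (wdot_cvg0 mw w_ge0 wL2_sub_limit Lv).
  apply: (squeeze_cvgr _ (cvg_cst 0) tail0).
  near=> n; rewrite wdot_ge0 //= -lee_fin.
  by rewrite -(wL2_integralE mw w_ge0 (wL2_sub_limit n)) tail_integral_le.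
have psumE n : \sum_(a < n) c a * wdot v (e a) = wdot g v - wdot (fun x => g x - s n x) v.
  have Lg := wL2_pointwise_limit; have Ls := wL2_psum c n.
  rewrite wdotBl // wdot_psuml // opprB addrC subrK.
  by apply: eq_bigr => a _; rewrite wdotC.
rewrite (funext psumE) -[X in _ --> X]subr0.
by apply: cvgB => //; exact: cvg_cst.
Unshelve. all: by end_near.
Qed.

Lemma wdot_pointwise_limit_e b : wdot g (e b) = c b.
Proof.
rewrite -(cvg_lim _ (wdot_pointwise_limit (eL2 b))) //.
by apply: cvg_lim => //; exact: cvgn_psum_wdot_e.
Qed.

Lemma wdot_pointwise_limit_sqr : wdot g g = limn (fun n => S n).
Proof.
rewrite -(cvg_lim _ (wdot_pointwise_limit wL2_pointwise_limit)) //.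
by under eq_fun do under eq_bigr do rewrite wdot_pointwise_limit_e -expr2.
Qed.
End pointwise_limit.
End orthonormal_expansion.

Record diagonal_kernel_operator d (T : measurableType d) (R : realType)
    (mu : {measure set T -> \bar R}) (w : T -> R) (e : nat -> T -> R) (b : nat -> R)
    (k : T -> T -> R) (K : (T -> R) -> T -> R) : Prop := DiagonalKernelOperator {
  dk_measurable_weight : measurable_fun setT w;
  dk_weight_ge0 : forall x, 0 <= w x;
  dk_wL2 : forall a, wL2 mu w (e a);
  dk_orthonormal : forall a a', wdot mu w (e a) (e a') = (a == a')%:R;
  dk_coef_ge0 : forall a, 0 <= b a;
  dk_coef_le1 : forall a, b a <= 1;
  dk_expansion : forall x y, \sum_(a < n) b a * e a x * e a y @[n --> \oo] --> k y x;
  dk_wL2_image : forall u, wL2 mu w u -> wL2 mu w (K u);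
  dk_kernel : forall u v, wL2 mu w u -> wL2 mu w v ->
    wdot mu w (K u) v = Rintegral mu setT (fun x => Rintegral mu setT (fun y =>
      k y x * u x * v y * w y * w x)) }.

Section kernel_operator.
Context d (T : measurableType d) (R : realType).
Variables (mu : {measure set T -> \bar R}) (w : T -> R) (e : nat -> T -> R) (b : nat -> R).
Variables (k : T -> T -> R) (K : (T -> R) -> T -> R).
Hypothesis dk : diagonal_kernel_operator mu w e b k K.
Local Notation wL2 := (wL2 mu w).
Local Notation wdot := (wdot mu w).
Local Notation wnorm := (wnorm mu w).

Let mw := dk_measurable_weight dk.
Let w_ge0 := dk_weight_ge0 dk.
Let eL2 := dk_wL2 dk.
Let e_orthonormal := dk_orthonormal dk.
Let b_ge0 := dk_coef_ge0 dk.
Let b_le1 := dk_coef_le1 dk.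
Let k_expansion := dk_expansion dk.
Let K_wL2 := dk_wL2_image dk.

Let coef_mul_sqr_le a r : (b a * r) ^+ 2 <= b a * r ^+ 2.
Proof.
rewrite exprMn ler_wpM2r ?sqr_ge0 // expr2 -[leRHS]mulr1.
by rewrite ler_wpM2l.
Qed.

(* Convergence of the expansion on the diagonal [k x x], together with
   [0 <= b a <= 1], makes the coefficients of the section [k _ x] square-summable. *)
Let section_coef_cvg x : cvgn (fun n => \sum_(a < n) (b a * e a x) ^+ 2).
Proof.
have diag_cvg : cvgn (fun n => \sum_(a < n) b a * e a x ^+ 2).
  apply/cvg_ex; exists (k x x).
  by under eq_cvg do under eq_bigr do rewrite expr2 mulrA; exact: k_expansion.
apply: (@cvgn_psum_bounded _ (fun a => (b a * e a x) ^+ 2)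
  (limn (fun n => \sum_(a < n) b a * e a x ^+ 2))).
  by move=> a; exact: sqr_ge0.
move=> n; apply: le_trans (nondecreasing_cvgn_le _ diag_cvg n).
  by apply: ler_sum => a _; exact: coef_mul_sqr_le.
by apply: (@psum_nondecreasing _ (fun a => b a * e a x ^+ 2)) => a; rewrite mulr_ge0 ?sqr_ge0.
Qed.

Let wL2_section x : wL2 (fun y => k y x).
Proof.
exact: (wL2_pointwise_limit mw w_ge0 eL2 e_orthonormal (c := fun a => b a * e a x)
  (@section_coef_cvg x) (@k_expansion x)).
Qed.

Let wdot_section_sqr x :
  wdot (fun y => k y x) (fun y => k y x) = limn (fun n => \sum_(a < n) (b a * e a x) ^+ 2).
Proof.
exact: (wdot_pointwise_limit_sqr mw w_ge0 eL2 e_orthonormal (c := fun a => b a * e a x)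
  (@section_coef_cvg x) (@k_expansion x)).
Qed.

Let wdot_section x v : wL2 v ->
  \sum_(a < n) b a * e a x * wdot v (e a) @[n --> \oo] --> wdot (fun y => k y x) v.
Proof.
exact: (wdot_pointwise_limit mw w_ge0 eL2 e_orthonormal (c := fun a => b a * e a x)
  (g := fun y => k y x) (@section_coef_cvg x) (@k_expansion x)).
Qed.

Lemma wdot_K_expansion u v : wL2 u -> wL2 v ->
  \sum_(a < n) b a * wdot u (e a) * wdot v (e a) @[n --> \oo] --> wdot (K u) v.
Proof.
move=> Lu Lv; pose F x := wdot (fun y => k y x) v.
have F_cvg x : \sum_(a < n) b a * wdot v (e a) * e a x @[n --> \oo] --> F x.
  by under eq_cvg do under eq_bigr do rewrite mulrAC; exact: wdot_section.
have coef_cvg : cvgn (fun n => \sum_(a < n) (b a * wdot v (e a)) ^+ 2).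
  apply: (@cvgn_psum_bounded _ (fun a => (b a * wdot v (e a)) ^+ 2) (wdot v v)).
    by move=> a; exact: sqr_ge0.
  move=> n.
  apply: le_trans (bessel mw w_ge0 eL2 e_orthonormal n Lv).
  apply: ler_sum => a _; apply: le_trans (coef_mul_sqr_le a _) _.
  by rewrite ler_piMl ?sqr_ge0.
have -> : wdot (K u) v = wdot F u.
  rewrite (dk_kernel dk) //; apply: eq_Rintegral => x _.
  transitivity (Rintegral mu setT (fun y => u x * w x * (k y x * v y * w y))).
    by apply: eq_Rintegral => y _; ring.
  rewrite RintegralZl //; first by rewrite /F /wdot; ring.
  exact: (wL2_integrable_mul mw w_ge0 (wL2_section x) Lv).
under eq_cvg do under eq_bigr do rewrite mulrAC.
exact: (wdot_pointwise_limit mw w_ge0 eL2 e_orthonormal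
  (c := fun a => b a * wdot v (e a)) coef_cvg F_cvg Lu).
Qed.

Lemma wdot_K_e u a : wL2 u -> wdot (K u) (e a) = b a * wdot u (e a).
Proof.
move=> Lu; apply: (cvg_unique _ (wdot_K_expansion Lu (eL2 a))) => //.
exact: (cvgn_psum_wdot_e e_orthonormal (c := fun i => b i * wdot u (e i))).
Qed.

Lemma wdot_K_sym u v : wL2 u -> wL2 v -> wdot (K u) v = wdot u (K v).
Proof.
move=> Lu Lv; rewrite [RHS]wdotC -(cvg_lim _ (wdot_K_expansion Lu Lv)) //.
under eq_fun do under eq_bigr do rewrite mulrAC.
exact/cvg_lim/wdot_K_expansion.
Qed.

Lemma wdot_K_ge0 u : wL2 u -> 0 <= wdot (K u) u.
Proof.
move=> Lu; have Ku := wdot_K_expansion Lu Lu.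
rewrite -(cvg_lim _ Ku) //; apply: limr_ge; first by apply/cvg_ex; eexists; exact: Ku.
by near=> n; apply: sumr_ge0 => a _; rewrite -mulrA mulr_ge0 // -expr2 sqr_ge0.
Unshelve. all: by end_near.
Qed.

Lemma wnorm_K_expansion u : wL2 u ->
  \sum_(a < n) b a ^+ 2 * wdot u (e a) ^+ 2 @[n --> \oo] --> wnorm (K u) ^+ 2.
Proof.
move=> Lu; rewrite wnorm_sqr //.
have E : (fun n => \sum_(a < n) b a ^+ 2 * wdot u (e a) ^+ 2) =1
         (fun n => \sum_(a < n) b a * wdot u (e a) * wdot (K u) (e a)).
  by move=> n; apply: eq_bigr => a _; rewrite wdot_K_e // mulrACA -!expr2.
by rewrite (eq_cvg _ _ E); exact: (wdot_K_expansion Lu (K_wL2 Lu)).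
Qed.

Lemma wnorm_K_sub_psum_cvg0 u : wL2 u ->
  wnorm (fun y => K u y - \sum_(a < n) b a * wdot u (e a) * e a y) @[n --> \oo] --> 0.
Proof.
move=> Lu; rewrite /wnorm -[X in _ --> X]sqrtr0; apply: (continuous_cvg _ (@sqrt_continuous R 0)).
have E : (fun n => wdot (fun y => K u y - \sum_(a < n) b a * wdot u (e a) * e a y)
                        (fun y => K u y - \sum_(a < n) b a * wdot u (e a) * e a y)) =1
         (fun n => wdot (K u) (K u) - \sum_(a < n) b a ^+ 2 * wdot u (e a) ^+ 2).
  move=> n; under eq_bigr do rewrite -exprMn.
  exact: (wdot_sub_psum mw w_ge0 eL2 e_orthonormal (c := fun a => b a * wdot u (e a))
    (K_wL2 Lu) (fun a _ => wdot_K_e a Lu)).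
have tail0 : wdot (K u) (K u) - \sum_(a < n) b a ^+ 2 * wdot u (e a) ^+ 2
    @[n --> \oo] --> 0.
  rewrite -[X in _ --> X](subrr (wdot (K u) (K u))); apply: cvgB; first exact: cvg_cst.
  by rewrite -wnorm_sqr //; exact: wnorm_K_expansion.
by rewrite (eq_cvg _ _ E).
Qed.

Lemma wdot_Ke_e a i : wdot (K (e a)) (e i) = b a * (a == i)%:R.
Proof. by rewrite wdot_K_e // e_orthonormal; case: eqVneq => [->|]; rewrite ?mulr0. Qed.

Lemma wnorm_K_e a : wnorm (K (e a)) ^+ 2 = b a ^+ 2.
Proof.
have Le := eL2 a; have LKe := K_wL2 Le.
rewrite wnorm_sqr // wdot_K_sym // wdotC wdot_K_e // wdot_K_e //.
by rewrite e_orthonormal eqxx mulr1 expr2.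
Qed.

Lemma K_eigen (e_complete : forall f, wL2 f -> (forall a, wdot f (e a) = 0) ->
    {ae mu, forall y, f y = 0}) a :
  {ae mu, forall y, K (e a) y = b a * e a y}.
Proof.
have Le := eL2 a; have LKe := K_wL2 Le; have Lbe := wL2Z mw w_ge0 (b a) Le.
have : {ae mu, forall y, K (e a) y - b a * e a y = 0}.
  apply: e_complete => [|i]; first exact: wL2B.
  by rewrite wdotBl // wdotZl // wdot_Ke_e e_orthonormal subrr.
by apply: filterS => y /eqP; rewrite subr_eq0 => /eqP.
Qed.

(* Parseval's identity for the section [k _ x]. *)
Let integral_section_sqr x : (\int[mu]_y ((k y x) ^+ 2 * w y * w x)%:E)%E =
  (\sum_(a <oo) ((b a * e a x) ^+ 2 * w x)%:E)%E.
Proof.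
have [mk _] := wL2_section x.
transitivity ((w x)%:E * \int[mu]_y ((k y x) ^+ 2 * w y)%:E)%E.
  rewrite -ge0_integralZl_EFin //.
  - by apply: eq_integral => y _; rewrite -EFinM mulrC.
  - by move=> y _; rewrite lee_fin mulr_ge0 ?sqr_ge0.
  - by apply/measurable_EFinP; apply: measurable_funM => //; exact: measurable_funX.
rewrite (wL2_integralE mw w_ge0 (wL2_section x)) wdot_section_sqr -EFinM.
apply/esym/nneseries_EFin_cvgP => [a|]; first by rewrite mulr_ge0 ?sqr_ge0.
under eq_cvg do rewrite -mulr_suml.
by rewrite mulrC; apply: cvgM; [exact: section_coef_cvg | exact: cvg_cst].
Qed.

Let integral_coef_sqr a : (\int[mu]_x ((b a * e a x) ^+ 2 * w x)%:E)%E = (b a ^+ 2)%:E.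
Proof.
have [me _] := eL2 a.
transitivity ((b a ^+ 2)%:E * \int[mu]_x ((e a x) ^+ 2 * w x)%:E)%E.
  rewrite -ge0_integralZl_EFin ?sqr_ge0 //.
  - by apply: eq_integral => x _; rewrite -EFinM exprMn -mulrA.
  - by move=> x _; rewrite lee_fin mulr_ge0 ?sqr_ge0.
  - by apply/measurable_EFinP; apply: measurable_funM => //; exact: measurable_funX.
by rewrite (wL2_integralE mw w_ge0 (eL2 a)) e_orthonormal eqxx -EFinM mulr1.
Qed.

Lemma psum_coef_sqr_cvg c :
  (\int[mu]_x \int[mu]_y ((k y x) ^+ 2 * w y * w x)%:E)%E = (c ^+ 2)%:E ->
  \sum_(a < n) b a ^+ 2 @[n --> \oo] --> c ^+ 2.
Proof.
under eq_integral do rewrite integral_section_sqr.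
rewrite integral_nneseries //; last 2 first.
- move=> a; apply/measurable_EFinP; apply: measurable_funM => //.
  by apply: measurable_funX; apply: measurable_funM => //; case: (eL2 a).
- by move=> a x _; rewrite lee_fin mulr_ge0 ?sqr_ge0.
under eq_eseriesr do rewrite integral_coef_sqr.
by move/nneseries_EFin_cvgP; apply => a; exact: sqr_ge0.
Qed.

Lemma psum_wnorm_K_e_cvg c :
  (\int[mu]_x \int[mu]_y ((k y x) ^+ 2 * w y * w x)%:E)%E = (c ^+ 2)%:E ->
  \sum_(a < n) wnorm (K (e a)) ^+ 2 @[n --> \oo] --> c ^+ 2.
Proof.
move=> kc; under eq_cvg do under eq_bigr do rewrite wnorm_K_e.
exact: psum_coef_sqr_cvg.
Qed.

End kernel_operator.

Section heat_semigroup_eigenvalues.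
Variables (R : realType) (lam : nat -> R) (t : R).

Lemma bt_gt0 a : 0 < bt lam t a.
Proof. exact: expR_gt0. Qed.

Lemma bt_eq1 a : lam a = 0 -> bt lam t a = 1.
Proof. by rewrite /bt => ->; rewrite mul0r oppr0 expR0. Qed.

Lemma bt_le1 a : 0 <= lam a -> 0 <= t -> bt lam t a <= 1.
Proof. by move=> la t0; rewrite /bt expR_le1 oppr_le0 mulr_ge0. Qed.

Lemma bt_lt1 a : 0 < lam a -> 0 < t -> bt lam t a < 1.
Proof. by move=> la t0; rewrite /bt expR_lt1 oppr_lt0 mulr_gt0. Qed.

Lemma bt_le a a' : 0 <= t -> lam a <= lam a' -> bt lam t a' <= bt lam t a.
Proof. by move=> t0 la; rewrite /bt ler_expR lerN2 ler_wpM2r. Qed.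
End heat_semigroup_eigenvalues.

Lemma spectrum_ge0 (R : realType) (lam : nat -> R) : lam 0%N = 0 -> 0 < lam 1%N ->
  (forall a, (1 <= a)%N -> lam a <= lam a.+1) -> forall a, 0 <= lam a.
Proof.
move=> lam0 lam1 lam_mono [|a]; first by rewrite lam0.
elim: a => [|a IH]; first exact: ltW.
exact: le_trans IH (lam_mono _ _).
Qed.

Section kernel_density_estimate.
Variables (R : realType) (nu nd : nat) (eta : 'I_nd -> 'I_nu -> R).
Hypothesis nd_gt1 : (1 < nd)%N.
Local Notation X := (Rsp R nu).

Lemma s_bw_gt0 : 0 < @s_bw R nu nd.
Proof.
apply: powR_gt0; apply: divr_gt0 => //; apply: mulr_gt0; first by rewrite ltr0n; lia.
by rewrite ltr_wpDr // ler0n.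
Qed.

Lemma shat_gt0 : 0 < @shat R nu nd.
Proof.
apply: divr_gt0; first exact: s_bw_gt0.
rewrite sqrtr_gt0 ltr_wpDr ?exprn_gt0 ?s_bw_gt0 // divr_ge0 ?ler0n //.
by rewrite subr_ge0 ler1n; lia.
Qed.

Lemma pH_gt0 (y : X) : 0 < pH eta y.
Proof.
have c_gt0 : 0 < (Num.sqrt (2 * pi) * @shat R nu nd) ^- nu.
  by rewrite invr_gt0 exprn_gt0 // mulr_gt0 ?shat_gt0 // sqrtr_gt0 mulr_gt0 ?pi_gt0.
have term_gt0 r : 0 < (Num.sqrt (2 * pi) * @shat R nu nd) ^- nu * expR r.
  exact: mulr_gt0 c_gt0 (expR_gt0 r).
rewrite /pH div1r mulr_gt0 ?invr_gt0 ?ltr0n; [|lia|] => //.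
rewrite (bigD1 (Ordinal (ltnW nd_gt1))) //=.
by apply: ltr_wpDr; [apply: sumr_ge0 => j _; exact: ltW | exact: term_gt0].
Qed.

Variable q : nat -> X -> R.
Hypothesis q_measurable : forall a, measurable_fun setT (q a).
Hypothesis q_L2 : forall a, (\int[leb R nu]_y ((q a y) ^+ 2)%:E < +oo)%E.
Hypothesis q_orthonormal : forall a b,
  Rintegral (leb R nu) setT (fun y => q a y * q b y) = (a == b)%:R.
Hypothesis q_complete : forall f : X -> R, measurable_fun setT f ->
  (\int[leb R nu]_y ((f y) ^+ 2)%:E < +oo)%E ->
  (forall a, Rintegral (leb R nu) setT (fun y => f y * q a y) = 0) ->
  {ae leb R nu, forall y, f y = 0}.
Hypothesis q0E : forall y, q 0%N y = Num.sqrt (pH eta y).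

Local Notation wL2 := (wL2 (leb R nu) (pH eta)).
Local Notation wdot := (wdot (leb R nu) (pH eta)).

Let q0_gt0 y : 0 < q 0%N y.
Proof. by rewrite q0E sqrtr_gt0 pH_gt0. Qed.

Let pHE y : pH eta y = q 0%N y ^+ 2.
Proof. by rewrite q0E sqr_sqrtr // ltW // pH_gt0. Qed.

Let psi_pHE a y : psi eta q a y * pH eta y = q a y * q 0%N y.
Proof. by rewrite /psi -q0E pHE expr2 mulrA divfK // gt_eqF. Qed.

Lemma measurable_pH : measurable_fun setT (pH eta).
Proof. by rewrite (funext pHE); exact: measurable_funX. Qed.

Lemma measurable_psi a : measurable_fun setT (psi eta q a).
Proof.
have -> : psi eta q a = fun y => q a y * expR (- ln (q 0%N y)).
  by apply/funext => y; rewrite /psi -q0E expRN lnK // posrE.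
apply: measurable_funM => //; apply: measurableT_comp; first exact: measurable_expR.
by apply: measurableT_comp => //; apply: measurableT_comp => //; exact: measurable_ln.
Qed.

Lemma psi_wL2 a : wL2 (psi eta q a).
Proof.
split; first exact: measurable_psi.
rewrite (_ : (fun y => _) = fun y => ((q a y) ^+ 2)%:E) ?q_L2 //.
apply/funext => y; congr EFin.
by rewrite expr2 -mulrA psi_pHE /psi -q0E mulrCA divfK ?gt_eqF // expr2.
Qed.

Lemma psi_orthonormal a b : wdot (psi eta q a) (psi eta q b) = (a == b)%:R.
Proof.
rewrite -q_orthonormal; apply: eq_Rintegral => y _.
by rewrite -mulrA psi_pHE /psi -q0E mulrCA divfK ?gt_eqF // mulrC.
Qed.

Lemma psi_complete f : wL2 f -> (forall a, wdot f (psi eta q a) = 0) ->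
  {ae leb R nu, forall y, f y = 0}.
Proof.
move=> [mf fi] f_perp.
have : {ae leb R nu, forall y, f y * q 0%N y = 0}.
  apply: q_complete => [|| a]; first exact: measurable_funM.
    by under eq_integral do rewrite exprMn -pHE.
  rewrite -(f_perp a); apply: eq_Rintegral => y _.
  by rewrite -[RHS]mulrA psi_pHE [q a y * _]mulrC mulrA.
by apply: filterS => y /eqP; rewrite mulf_eq0 (gt_eqF (q0_gt0 y)) orbF => /eqP.
Qed.

Lemma psi_hilbert_basis : hilbert_basisH eta (psi eta q).
Proof. by split; [exact: psi_wL2 | split; [exact: psi_orthonormal | exact: psi_complete]]. Qed.

Lemma kt_expansion (lam : nat -> R) (rho : R -> X -> X -> R) t (x y : X) :
  (Num.sqrt (pH eta y) / Num.sqrt (pH eta x) *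
     \sum_(a < n) expR (- (lam a * t)) * q a y * q a x) @[n --> \oo] --> rho t y x ->
  \sum_(a < n) bt lam t a * psi eta q a x * psi eta q a y @[n --> \oo] --> kt eta rho t y x.
Proof.
move=> rho_cvg; have sx_neq0 : Num.sqrt (pH eta x) != 0 by rewrite gt_eqF ?sqrtr_gt0 ?pH_gt0.
have sy_neq0 : Num.sqrt (pH eta y) != 0 by rewrite gt_eqF ?sqrtr_gt0 ?pH_gt0.
have E : (fun n => \sum_(a < n) bt lam t a * psi eta q a x * psi eta q a y) =1
    (fun n => (Num.sqrt (pH eta y) / Num.sqrt (pH eta x) *
      \sum_(a < n) expR (- (lam a * t)) * q a y * q a x) * (pH eta y)^-1).
  move=> n; rewrite mulr_sumr mulr_suml; apply: eq_bigr => a _.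
  rewrite /bt /psi -{3}(sqr_sqrtr (ltW (pH_gt0 y))); field.
  by rewrite sx_neq0 sy_neq0.
by rewrite (eq_cvg _ _ E); exact: cvgM rho_cvg (cvg_cst _).
Qed.
End kernel_density_estimate.

Theorem proposition2 (R : realType) (nu nd : nat) (eta : 'I_nd -> 'I_nu -> R)
  (hnu : (1 <= nu)%N) (hnd : (1 < nd)%N)
  (heta_mean : forall i : 'I_nu, 1 / nd%:R * \sum_(j < nd) eta j i = 0)
  (heta_cov : forall i k : 'I_nu,
     1 / (nd%:R - 1) * \sum_(j < nd) eta j i * eta j k = (i == k)%:R)
  (* spectrum of \hat L *)
  (lam : nat -> R) (hlam0 : lam 0%N = 0) (hlam1 : 0 < lam 1%N)
  (hlam_mono : forall a, (1 <= a)%N -> lam a <= lam a.+1)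
  (hlam_mult : forall a, exists N, forall b, (N <= b)%N -> lam b != lam a)
  (* eigenfunctions q_alpha: orthonormal Hilbert basis of L^2(R^nu) *)
  (q : nat -> Rsp R nu -> R)
  (hq_meas : forall a, measurable_fun setT (q a))
  (hq_L2 : forall a, (\int[leb R nu]_y ((q a y) ^+ 2)%:E < +oo)%E)
  (hq_orth : forall a b,
     Rintegral (leb R nu) setT (fun y => q a y * q b y) = (a == b)%:R)
  (hq_complete : forall f : Rsp R nu -> R, measurable_fun setT f ->
     (\int[leb R nu]_y ((f y) ^+ 2)%:E < +oo)%E ->
     (forall a, Rintegral (leb R nu) setT (fun y => f y * q a y) = 0) ->
     {ae leb R nu, forall y, f y = 0})
  (hq0 : forall y, q 0%N y = Num.sqrt (pH eta y))
  (hq_diff : forall a (i : 'I_nu) (y : Rsp R nu),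
     derivable (fun h : R => q a (shiftp y i h)) 0 1 /\
     derivable (fun h : R => pdiff (q a) i (shiftp y i h)) 0 1)
  (hq_eig : forall a y, Lhat eta (q a) y = lam a * q a y)
  (hq_inf : forall a (e : R), 0 < e -> exists M : R, forall y, M < enorm y ->
     Num.sqrt (pH eta y) *
       Num.sqrt (gradsq (fun z => q a z / Num.sqrt (pH eta z)) y) < e)
  (* transition density: spectral representation *)
  (rho : R -> Rsp R nu -> Rsp R nu -> R)
  (hrho : forall t, 0 < t -> forall y x,
     (Num.sqrt (pH eta y) / Num.sqrt (pH eta x) *
        \sum_(a < n) expR (- (lam a * t)) * q a y * q a x) @[n --> \oo]
       --> rho t y x)
  (t : R) (ht : 0 < t)
  (c : R)
  (hc : (\int[leb R nu]_x \int[leb R nu]_y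
          ((kt eta rho t y x) ^+ 2 * pH eta y * pH eta x)%:E)%E = (c ^+ 2)%:E)
  (K : (Rsp R nu -> R) -> (Rsp R nu -> R))
  (hK_H : forall u, inH eta u -> inH eta (K u))
  (hK_lin : forall (r : R) u v, inH eta u -> inH eta v ->
     {ae leb R nu, forall y, K (fun z => r * u z + v z) y = r * K u y + K v y})
  (hK_bdd : exists C : R, forall u, inH eta u -> normH eta (K u) <= C * normH eta u)
  (hK_form : forall u v, inH eta u -> inH eta v ->
     ipH eta (K u) v =
     Rintegral (leb R nu) setT (fun x => Rintegral (leb R nu) setT (fun y =>
       kt eta rho t y x * u x * v y * pH eta y * pH eta x))) :
  (* (a) *)
  ((forall u v, inH eta u -> inH eta v ->
     (\sum_(a < n) bt lam t a * ipH eta u (psi eta q a) * ipH eta v (psi eta q a))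
       @[n --> \oo] --> ipH eta (K u) v) /\
   (forall u v, inH eta u -> inH eta v -> ipH eta (K u) v = ipH eta u (K v)) /\
   (forall u, inH eta u -> 0 <= ipH eta (K u) u) /\
   (forall u, inH eta u ->
     normH eta (fun y => K u y -
        \sum_(a < n) bt lam t a * ipH eta u (psi eta q a) * psi eta q a y)
       @[n --> \oo] --> 0)) /\
  (* (b) *)
  ((forall a, inH eta (psi eta q a) /\ 0 < bt lam t a /\
      {ae leb R nu, forall y, K (psi eta q a) y = bt lam t a * psi eta q a y}) /\
   bt lam t 0%N = 1 /\ bt lam t 1%N < bt lam t 0%N /\
   (forall a, (1 <= a)%N -> bt lam t a.+1 <= bt lam t a) /\
   (forall a b, ipH eta (K (psi eta q a)) (psi eta q b) = bt lam t a * (a == b)%:R)) /\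
  (* (c) *)
  ((forall u, inH eta u ->
     (\sum_(a < n) bt lam t a ^+ 2 * ipH eta u (psi eta q a) ^+ 2) @[n --> \oo]
       --> normH eta (K u) ^+ 2) /\
   (\sum_(a < n) normH eta (K (psi eta q a)) ^+ 2) @[n --> \oo] --> c ^+ 2 /\
   (\sum_(a < n) bt lam t a ^+ 2) @[n --> \oo] --> c ^+ 2 /\
   hilbert_schmidtH eta K).
Proof.
(* Only [hrho] carries the spectral information used below. *)
have w_ge0 y := ltW (pH_gt0 eta hnd y).
have lam_ge0 := spectrum_ge0 hlam0 hlam1 hlam_mono.
have psi_cpl := psi_complete hnd hq_meas hq_complete hq0.
have dk : diagonal_kernel_operator (leb R nu) (pH eta) (psi eta q) (bt lam t)
    (kt eta rho t) K.
  split => //.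
  - exact (measurable_pH hnd hq_meas hq0).
  - exact (psi_wL2 hnd hq_meas hq_L2 hq0).
  - exact (psi_orthonormal hnd hq_orth hq0).
  - by move=> a; exact/ltW/bt_gt0.
  - by move=> a; exact: bt_le1 (lam_ge0 a) (ltW ht).
  - by move=> x y; exact: kt_expansion (hrho t ht y x).
split; [split; [|split; [|split]] |
  split; [split; [|split; [|split; [|split]]] | split; [|split; [|split]]]].
- by move=> u v hu hv; exact (wdot_K_expansion dk hu hv).
- by move=> u v hu hv; exact (wdot_K_sym dk hu hv).
- by move=> u hu; exact (wdot_K_ge0 dk hu).
- by move=> u hu; exact (wnorm_K_sub_psum_cvg0 dk hu).
- move=> a; split; first exact (dk_wL2 dk a).
  by split; [exact: bt_gt0 | exact (K_eigen dk psi_cpl a)].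
- exact: bt_eq1.
- by rewrite (bt_eq1 _ hlam0) bt_lt1.
- by move=> a a_ge1; exact: bt_le (ltW ht) (hlam_mono a a_ge1).
- exact (wdot_Ke_e dk).
- by move=> u hu; exact (wnorm_K_expansion dk hu).
- exact (psum_wnorm_K_e_cvg dk hc).
- exact (psum_coef_sqr_cvg dk hc).
- exists (psi eta q); split; last by exists (c ^+ 2); exact (psum_wnorm_K_e_cvg dk hc).
  exact (psi_hilbert_basis hnd hq_meas hq_L2 hq_orth hq_complete hq0).
Qed.
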